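(* Let $X$ be a finite-dimensional strictly convex real Banach space. Then $X$ is a Hilbert space (i.e., its norm is induced by an inner product) if and only if the pair $(X,X)$ has L-P property.
   Context: All spaces are real. For a normed space $Z$, $B_Z$ is the closed unit ball and $E_Z$ is the set of all extreme points of $B_Z$. $L(Z,W)$ is the space of all bounded linear operators from $Z$ to $W$ with the usual operator norm. An operator $T\in L(Z,W)$ is an extreme contraction if it is an extreme point of the unit ball $B_{L(Z,W)}$. For Banach spaces $Z,W$, the pair $(Z,W)$ has L-P (Lindenstrauss–Perles) property if for every $T\in L(Z,W)$ with $\|T\|=1$: $T$ is an extreme contraction if and only if $T(E_Z)\subseteq E_W$. *)

(* Defs.v *)
From HB Require Import structures.
From mathcomp Require Import all_boot all_order all_algebra.
From mathcomp Require Import all_classical all_reals all_analysis.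

Set Implicit Arguments.
Unset Strict Implicit.
Unset Printing Implicit Defensive.

Import Order.TTheory GRing.Theory Num.Theory.
Import numFieldNormedType.Exports.

Local Open Scope classical_set_scope.
Local Open Scope ring_scope.

(* Finite dimension is supplied by [Vector], a linear isomorphism with some
   ['rV[R]_n]; it shares its linear structure with the normed module. *)
#[short(type="finDimBanachType")]
HB.structure Definition FinDimBanach (R : numFieldType) :=
  {T of CompleteNormedModule R T & Vector R T}.

Definition extreme_points (R : numDomainType) (V : lmodType R) (A : set V) :
    set V :=
  [set x | A x /\ forall (y z : V) (t : R), A y -> A z -> 0 < t < 1 ->
    x = t *: y + (1 - t) *: z -> y = x /\ z = x].

Definition unit_ball (R : realType) (Z : normedModType R) : set Z :=
  [set x | `|x| <= 1].

Definition strictly_convex (R : realType) (Z : normedModType R) : Prop :=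
  [set x : Z | `|x| = 1] `<=` extreme_points (@unit_ball R Z).

(* Operators are plain functions here: this makes [bounded_op Z W] a subset of
   the vector space [Z -> W], to which [extreme_points] applies, and equality
   of operators is equality of functions. *)
Definition bounded_op (R : realType) (Z W : normedModType R) : set (Z -> W) :=
  [set T | linear T /\ bounded_fun_norm T].

(* [sup] has a junk value on unbounded sets, so this is meaningful only for
   [T] in [bounded_op Z W]. *)
Definition op_norm (R : realType) (Z W : normedModType R) (T : Z -> W) : R :=
  sup [set `|T x| | x in @unit_ball R Z].

Definition op_unit_ball (R : realType) (Z W : normedModType R) :
    set (Z -> W) :=
  [set T | bounded_op T /\ op_norm T <= 1].

Definition extreme_contraction (R : realType) (Z W : normedModType R)
    (T : Z -> W) : Prop :=
  extreme_points (@op_unit_ball R Z W) T.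

Definition LP_property (R : realType) (Z W : completeNormedModType R) : Prop :=
  forall T : Z -> W, bounded_op T -> op_norm T = 1 ->
    (extreme_contraction T <->
     T @` extreme_points (@unit_ball R Z) `<=`
       extreme_points (@unit_ball R W)).

(* [idfun] in place of conjugation: over the reals, [{dot Z for idfun}] are the
   positive definite symmetric bilinear forms. Completeness comes with the type
   of [Z]. *)
Definition is_hilbert (R : realType) (Z : completeNormedModType R) : Prop :=
  exists f : {dot Z for idfun}, forall x : Z, `|x| = Num.sqrt (f x x).

(* Main.v *)
(* Over a Hilbert space, a contraction [T] which is not an isometry can be
   perturbed: [T + S] and [T - S] are contractions for a suitable rank one
   operator [S], so [T] is not extreme. Conversely, given the L-P property,
   extreme points of the face of contractions mapping some fixed unit vector
   [x0] to a unit vector [y] are isometries, so the isometries act transitively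
   on the sphere from [x0]; a positive definite form invariant under all
   isometries is then constant on the sphere. *)
From HB Require Import structures.
Require Import Defs.
From mathcomp Require Import all_boot all_order all_algebra.
From mathcomp Require Import all_classical all_reals all_analysis.
From mathcomp Require Import ring lra.

Set Implicit Arguments.
Unset Strict Implicit.
Unset Printing Implicit Defensive.

Import Order.TTheory GRing.Theory Num.Theory.
Import numFieldNormedType.Exports passmx.

Local Open Scope classical_set_scope.
Local Open Scope ring_scope.

(** By strict convexity every unit vector is extreme, so the inclusion of extreme points in the L-P
    property says that the operator is an isometry. The base point [x0] is a unit vector of largest
    Euclidean norm: Cauchy-Schwarz for the rescaled Euclidean form [D] makes [D x x0] a functional
    of norm one attained at [x0], which yields a rank one contraction in each face. The invariant
    form does not come from averaging over the isometry group, which would take a Haar measure: it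
    minimises, over a compact set of forms, the supremum of strictly convex functions indexed by the
    isometries. Such a supremum need not be strictly convex, so the gain at a midpoint has to be
    bounded below uniformly in the isometry. *)

Lemma linear_packP (R : pzRingType) (U V : lmodType R) (T : U -> V) :
  linear T -> exists T' : {linear U -> V}, T = T' :> (U -> V).
Proof.
move=> linT.
pose T' : {linear U -> V} := HB.pack T (GRing.isLinear.Build _ _ _ _ T linT).
by exists T'.
Qed.

Lemma linear_inj_surj (K : fieldType) (V : vectType K) (T : V -> V) :
  linear T -> (forall x, T x = 0 -> x = 0) -> forall y, exists x, T x = y.
Proof.
move=> /linear_packP[{}T ->] T0 y.
have kerT : lker (linfun T) == 0%VS.
  apply/lker0P => u v; rewrite !lfunE => Tuv.
  by apply/subr0_eq/T0; rewrite linearB/= Tuv subrr.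
by exists ((linfun T)^-1%VF y); rewrite -[LHS](lfunE T) lker0_lfunVK.
Qed.

(** * Contractions, operator norm and extreme points of the ball *)

Section contraction.
Variables (R : realType) (X : finDimBanachType R).
Implicit Types (T : X -> X) (x y : X).

Lemma contraction_op_unit_ball T :
  linear T -> (forall x : X, `|T x| <= `|x|) -> op_unit_ball T.
Proof.
move=> linT cT; split; first split=> //.
  by move=> r; exists r => x xr; exact: le_trans (cT x) xr.
apply: ge_sup; first by exists `|T 0|, 0 => //=; rewrite /unit_ball/= normr0.
by move=> _ [x x1 <-]; exact: le_trans (cT x) x1.
Qed.

Lemma op_unit_ball_contraction T :
  op_unit_ball T -> forall x : X, `|T x| <= `|x|.
Proof.
move=> [[linT bT] T1] x.
have [Tl TlE] := linear_packP linT.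
have [->|x0] := eqVneq x 0; first by rewrite TlE linear0 normr0.
have nx : 0 < `|x| by rewrite normr_gt0.
have : `|T (`|x|^-1 *: x)| <= 1.
  apply: le_trans T1; apply: ub_le_sup.
    by have [M TM] := bT 1; exists M => _ [z z1 <-]; exact: TM.
  exists (`|x|^-1 *: x) => //.
  by rewrite /unit_ball/= normrZ normfV normr_id mulVf ?gt_eqF.
by rewrite TlE linearZ normrZ normfV normr_id ler_pdivrMl// mulr1.
Qed.

Lemma op_norm1_nontrivial T : op_norm T = 1 -> exists x : X, `|x| = 1.
Proof.
move=> T1; apply: contrapT => nX.
have X0 x : x = 0.
  apply: contrapT => /eqP x0; apply: nX; exists (`|x|^-1 *: x).
  by rewrite normrZ normfV normr_id mulVf// normr_eq0.
move: T1; rewrite /op_norm (_ : [set _ | _ in _] = [set 0]).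
  by rewrite sup1 => /esym/eqP; rewrite oner_eq0.
apply/seteqP; split=> [_ [x _ <-]|_ ->]/=; first by rewrite (X0 (T x)) normr0.
by exists 0; rewrite ?(X0 (T 0)) ?normr0// /unit_ball/= normr0.
Qed.

Lemma contraction_op_norm T x :
  (forall z : X, `|T z| <= `|z|) -> `|x| = 1 -> `|T x| = 1 -> op_norm T = 1.
Proof.
move=> cT x1 Tx1; have ub1 : ubound [set `|T z| | z in @unit_ball R X] 1.
  by move=> _ [z z1 <-]; exact: le_trans (cT z) z1.
apply/eqP; rewrite eq_le; apply/andP; split.
  by apply: ge_sup ub1; exists `|T x|, x => //=; rewrite /unit_ball/= x1.
apply: ub_le_sup; first by exists 1.
by exists x; rewrite // /unit_ball/= x1.
Qed.

(** A point of norm less than 1 is the midpoint of two points of the ball displaced along [e] and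
    [- e]. The vector [e] excludes the zero space, where 0 is extreme. *)
Lemma norm_extreme_point x (e : X) : `|e| = 1 ->
  extreme_points (@unit_ball R X) x -> `|x| = 1.
Proof.
move=> e1 [x1 xe]; apply: contrapT => /eqP xn1.
have lt1 : 0 < 1 - `|x| by rewrite subr_gt0 lt_neqAle xn1.
have bnd s : `|s| = 1 -> unit_ball (x + (s * (1 - `|x|)) *: e).
  move=> s1; rewrite /unit_ball/= (le_trans (ler_normD _ _))// normrZ e1 mulr1.
  by rewrite normrM s1 mul1r (gtr0_norm lt1) addrC subrK.
have [||//||] := xe _ _ 2^-1 (bnd 1 _) (bnd (-1) _).
- by rewrite normr1.
- by rewrite normrN1.
- by apply/andP; split; lra.
- rewrite !scalerDr !scalerA addrACA -!scalerDl.
  rewrite [X in X *: x](_ : _ = 1); last lra.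
  by rewrite [X in X *: e](_ : _ = 0) ?scale0r ?addr0 ?scale1r//; lra.
move=> /eqP; rewrite -subr_eq0 addrC addKr mul1r scaler_eq0 gt_eqF//= => /eqP e0 _.
by move: e1; rewrite e0 normr0 => /esym/eqP; rewrite oner_eq0.
Qed.

End contraction.

(** * Symmetric bilinear forms *)

(** A predicate on plain functions, without positivity, so that it covers differences and pullbacks
    of forms. *)
Definition sym_bilinear (R : pzRingType) (V : lmodType R)
    (f : V -> V -> R) : Prop :=
  (forall z, scalar (f^~ z)) /\ (forall x y, f x y = f y x).

Section sym_bilinear.
Variables (R : pzRingType) (V : lmodType R) (f : V -> V -> R).
Hypothesis sf : sym_bilinear f.
Implicit Types x y z : V.

Lemma sfC x y : f x y = f y x. Proof. exact: sf.2. Qed.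

Lemma sfDl x y z : f (x + y) z = f x z + f y z.
Proof. by have := sf.1 z 1 x y; rewrite scale1r mul1r. Qed.

Lemma sf0l z : f 0 z = 0.
Proof. by apply: (addrI (f 0 z)); rewrite -sfDl !addr0. Qed.

Lemma sfZl a x z : f (a *: x) z = a * f x z.
Proof. by have := sf.1 z a x 0; rewrite sf0l !addr0. Qed.

Lemma sfBl x y z : f (x - y) z = f x z - f y z.
Proof. by rewrite sfDl -scaleN1r sfZl mulN1r. Qed.

Lemma sfDr x y z : f z (x + y) = f z x + f z y.
Proof. by rewrite !(sfC z) sfDl. Qed.

Lemma sfZr a x z : f z (a *: x) = a * f z x.
Proof. by rewrite !(sfC z) sfZl. Qed.

Lemma sfBr x y z : f z (x - y) = f z x - f z y.
Proof. by rewrite !(sfC z) sfBl. Qed.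

End sym_bilinear.

Lemma sym_bilinearB (R : comPzRingType) (V : lmodType R)
    (f g : V -> V -> R) :
  sym_bilinear f -> sym_bilinear g ->
  sym_bilinear (fun x y => f x y - g x y).
Proof.
move=> sf sg; split=> [z a x y|x y].
  by rewrite (sf.1 z) (sg.1 z) opprD addrACA mulrBr.
by rewrite (sfC sf) (sfC sg).
Qed.

Lemma sym_bilinear_comp (R : pzRingType) (U V : lmodType R)
    (T : U -> V) (f : V -> V -> R) :
  linear T -> sym_bilinear f -> sym_bilinear (fun x y => f (T x) (T y)).
Proof.
move=> linT sf; split=> [z a x y|x y]; first by rewrite linT (sf.1 (T z)).
by rewrite (sfC sf).
Qed.

(* A Cauchy-Schwarz inequality, with [+ 1] avoiding the case [g z z = 0]. *)
Lemma psd_cauchy_schwarz (R : realFieldType) (V : lmodType R)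
    (g : V -> V -> R) :
  sym_bilinear g -> (forall x, 0 <= g x x) ->
  forall x z, g x z ^+ 2 <= (g z z + 1) * g x x.
Proof.
move=> sg g0 x z; set c := g z z + 1.
have c0 : 0 < c by rewrite ltr_wpDl.
(* With [g z z = c - 1], expanding gives [c * (c * g x x - g x z ^+ 2) - g x z ^+ 2 >= 0]. *)
have := g0 (c *: x - g x z *: z).
rewrite (sfBl sg) !(sfBr sg) !(sfZl sg) !(sfZr sg) (sfC sg z x) => h.
have gz : g z z = c - 1 by rewrite /c addrK.
rewrite gz in h; rewrite -subr_ge0 -(pmulr_rge0 _ c0).
apply: le_trans h _; rewrite -subr_ge0.
rewrite (_ : _ - _ = g x z ^+ 2) ?sqr_ge0//; ring.
Qed.

(** * Inner products, adjoints and perturbation of contractions *)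

Section hilbert.
Variables (R : realType) (X : finDimBanachType R).

Lemma is_hilbertP : is_hilbert X <->
  exists2 f : X -> X -> R, sym_bilinear f & forall x, f x x = `|x| ^+ 2.
Proof.
split=> [[f fE]|[f sf fE]].
  exists f.
    split=> [z a x y|x y]; first by rewrite linearPl.
    by rewrite hermC/= expr0 mul1r.
  move=> x; rewrite fE sqr_sqrtr//.
  have [->|x0] := eqVneq x 0; first by rewrite linear0l.
  by rewrite ltW// neq0_dnorm_gt0.
have fb : bilinear_for *%R *%R f.
  split=> z a x y /=; first exact: sf.1.
  by rewrite (sfDr sf) (sfZr sf).
have fh u v : f u v = (-1) ^+ false * idfun (f v u).
  by rewrite expr0 mul1r; exact: sfC.
have f0 u : u != 0 -> 0 < f u u by move=> u0; rewrite fE; apply: exprn_gt0; rewrite normr_gt0.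
pose mB := isBilinear.Build R X X R *%R (idfun \; *%R) f
  (fun z => zmod_morphism_linear (fb.1 z)) (fun z => zmod_morphism_linear (fb.2 z))
  (fun z => scalable_linear (fb.1 z)) (fun z => scalable_linear (fb.2 z)).
pose mH := isHermitianSesquilinear.Build R X false idfun f fh.
pose f2 : {dot X for idfun} := HB.pack f mB mH (isDotProduct.Build R X f f0).
by exists f2 => x; rewrite [f2 x x]fE sqrtr_sqr normr_id.
Qed.

Local Notation b := (vbasis {:X}).

Lemma eq_scalar_basis (f g : X -> R) : scalar f -> scalar g ->
  (forall i : 'I_(\dim {:X}), f b`_i = g b`_i) -> f =1 g.
Proof.
move=> /linear_packP[{}f ->] /linear_packP[{}g ->] fg x.
rewrite (coord_vbasis (memvf x)) !linear_sum; apply: eq_bigr => i _.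
by rewrite !linearZ/= fg.
Qed.

Section inner_product.
Variable f : X -> X -> R.
Hypotheses (sf : sym_bilinear f) (fE : forall x, f x x = `|x| ^+ 2).

Lemma inner_product_eq0 w : (forall x, f x w = 0) -> w = 0.
Proof. by move=> /(_ w); rewrite fE => /eqP; rewrite sqrf_eq0 normr_eq0 => /eqP. Qed.

(** The values of [f] on the basis, read back as coordinates, define an endomorphism [J] of [X]; it
    is injective since [f] is definite, hence onto. *)
Lemma riesz_representation (phi : X -> R) :
  scalar phi -> exists w, forall x, phi x = f x w.
Proof.
move=> lphi.
pose J w : X := vecof b (\row_i f b`_i w).
have vecb_inj := can_inj (vecofK (vbasisP {:X})).
have linJ : linear J.
  move=> a x y; rewrite /J -linearP; congr (vecof b).
  by apply/rowP => i; rewrite !mxE (sfDr sf) (sfZr sf).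
have J0 w : J w = 0 -> w = 0.
  rewrite -[RHS](linear0 (vecof b)) => /vecb_inj/rowP Jw; apply: inner_product_eq0.
  apply: (@eq_scalar_basis (f^~ w) (fun=> 0)); first exact: sf.1.
    by move=> a x y; rewrite mulr0 addr0.
  by move=> i; have := Jw i; rewrite !mxE.
have [w Jw] := linear_inj_surj linJ J0 (vecof b (\row_i phi b`_i)).
exists w; apply: (@eq_scalar_basis phi (f^~ w)) => //; first exact: sf.1.
by move=> i; have /rowP/(_ i) := vecb_inj _ _ Jw; rewrite !mxE.
Qed.

Lemma adjoint_exists (T : X -> X) : linear T ->
  exists2 T' : X -> X, linear T' & forall x y, f (T x) y = f x (T' y).
Proof.
move=> linT.
have /choice[T' adjT] : forall y, exists w, forall x, f (T x) y = f x w.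
  move=> y; apply: (@riesz_representation (fun x => f (T x) y)) => a u v.
  by rewrite linT sf.1.
exists T' => // a x y; apply/eqP; rewrite -subr_eq0; apply/eqP.
apply: inner_product_eq0 => z.
rewrite (sfBr sf) (sfDr sf) (sfZr sf) -!adjT (sfDr sf) (sfZr sf).
by rewrite subrr.
Qed.

(* If [T] is not an isometry then, with [T'] the adjoint of [T], both
   [1 - T' T] and [1 - T T'] are nonzero. For [v] in the range of the former
   and [u] in that of the latter, both functionals [f x v] and [f (T x) u] are
   dominated by the square root of [`|x| ^+ 2 - `|T x| ^+ 2], so that a small
   multiple of [x |-> f x v *: u] can be added to or subtracted from [T]. *)
Lemma contraction_perturbation (T : X -> X) :
  linear T -> (forall x : X, `|T x| <= `|x|) ->
  (exists z : X, `|T z| != `|z|) ->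
  exists S : X -> X, [/\ linear S, exists x, S x != 0,
    forall x : X, `|T x + S x| <= `|x| & forall x : X, `|T x - S x| <= `|x|].
Proof.
move=> linT cT [z Tz].
pose g x y := f x y - f (T x) (T y).
have sg : sym_bilinear g.
  exact: (sym_bilinearB sf (sym_bilinear_comp linT sf)).
have g0 x : 0 <= g x x.
  by rewrite /g !fE subr_ge0 ler_pXn2r ?nnegrE.
have gz : 0 < g z z.
  rewrite lt_neqAle g0 andbT eq_sym /g !fE subr_eq0 eq_sym.
  by rewrite eqrXn2 ?normr_ge0.
have [T' linT' adj] := adjoint_exists linT.
have gE x y : g x y = f x (y - T' (T y)) by rewrite (sfBr sf) -adj.
have [Tl TE] := linear_packP linT.
have [Tl' TE'] := linear_packP linT'.
(* If [T T' = 1], then [T'] is injective, hence onto; writing [z = T' x] gives [T' (T z) = z],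
   against [0 < g z z]. *)
have [y Qy] : exists y, y - T (T' y) != 0.
  apply: contrapT => nQ.
  have TT' y : T (T' y) = y.
    by apply/esym/subr0_eq; apply: contrapT => /eqP Qy; apply: nQ; exists y.
  have T'0 x : T' x = 0 -> x = 0.
    by move=> T'x; rewrite -(TT' x) T'x TE linear0.
  have [x T'x] := linear_inj_surj linT' T'0 z.
  by move: gz; rewrite gE -T'x TT' subrr (sfC sf) (sf0l sf) ltxx.
set u := y - T (T' y) in Qy *.
have Tu x : f (T x) u = g x (T' y).
  by rewrite adj gE /u TE' linearB.
set s := T' y in Tu.
(* In the expansion of the squared norm of [T x + k *: S x], the terms [g z z + 1 + (g s s + 1)]
   absorb the cross term and [(g z z + 1) * f u u] the square of [S x]; the last 1 ensures [e <= 1],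
   so that [e ^+ 2 <= e]. *)
pose e := (g z z + 1 + (g s s + 1) + (g z z + 1) * f u u + 1)^-1.
have fu : 0 <= f u u by rewrite fE sqr_ge0.
have gs := g0 s.
have e0 : 0 < e.
  have gfu := mulr_ge0 (addr_ge0 (ltW gz) ler01) fu.
  by rewrite invr_gt0; lra.
pose S x := (e * g x z) *: u.
have bnd x k : k ^+ 2 = 1 -> `|T x + k *: S x| <= `|x|.
  move=> k1; rewrite -(@ler_pXn2r _ 2)// ?nnegrE//.
  rewrite -!fE !(sfDl sf) !(sfDr sf) !(sfZl sf) !(sfZr sf) (sfC sf u) Tu.
  have a2 := psd_cauchy_schwarz sg g0 x z.
  have b2 := psd_cauchy_schwarz sg g0 x s.
  have Gx : g x x = f x x - f (T x) (T x) by [].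
  move: (g0 x) a2 b2 gz gs fu e0 Gx; rewrite /e.
  move: (g x z) (g x s) (g x x) (g z z) (g s s) (f u u) (f x x) (f (T x) (T x)).
  move=> a b G A B U p q G0 a2 b2 A0 B0 U0.
  set E := (X in X^-1); rewrite invr_gt0 => E0 Gx.
  rewrite -subr_ge0 -(pmulr_rge0 _ (exprn_gt0 2 E0)).
  have -> : E ^+ 2 * (p - (q + k * (E^-1 * a * b) +
      (k * (E^-1 * a * b) + k * (E^-1 * a * (k * (E^-1 * a * U)))))) =
      E ^+ 2 * G - 2 * E * (k * a * b) - k ^+ 2 * a ^+ 2 * U.
    by rewrite Gx; field; rewrite gt_eqF.
  rewrite k1 mul1r.
  have kab : 2 * (k * a * b) <= a ^+ 2 + b ^+ 2.
    by have := sqr_ge0 (a - k * b); rewrite sqrrB exprMn k1; lra.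
  have E1 : 1 <= E by rewrite lerDr; nra.
  have : 2 * (k * a * b) <= (A + 1 + (B + 1)) * G by nra.
  have : a ^+ 2 * U <= ((A + 1) * G) * U by rewrite ler_wpM2r.
  move=> h1 h2.
  have h3 : E * (2 * (k * a * b)) <= E * ((A + 1 + (B + 1)) * G).
    by rewrite ler_wpM2l// ltW.
  have h4 : (A + 1) * G * U <= E * ((A + 1) * G * U).
    by rewrite ler_peMl// !mulr_ge0// addr_ge0// ltW.
  have h5 : E ^+ 2 * G = E * ((A + 1 + (B + 1)) * G) + E * ((A + 1) * G * U) + E * G.
    by rewrite /E; ring.
  have h6 : 0 <= E * G by rewrite mulr_ge0// ltW.
  by rewrite h5; lra.
exists S; split.
- by move=> a x w; rewrite /S sg.1 mulrDr scalerDl mulrCA scalerA.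
- by exists z; rewrite /S scaler_eq0 mulf_eq0 !gt_eqF.
- by move=> x; have := bnd x 1; rewrite scale1r expr1n; exact.
- by move=> x; have := bnd x (- 1); rewrite scaleN1r sqrrN expr1n; exact.
Qed.

End inner_product.
End hilbert.

(** * Strict convexity: extreme contractions against isometries *)

Section strictly_convex.
Variables (R : realType) (X : finDimBanachType R).
Hypothesis scX : strictly_convex X.

(** At a unit vector the image under [T] is extreme, so two contractions having [T] as a proper
    convex combination agree with [T] on the sphere, hence everywhere by homogeneity. *)
Lemma isometry_extreme_contraction (T : X -> X) :
  op_unit_ball T ->
  T @` extreme_points (@unit_ball R X) `<=` extreme_points (@unit_ball R X) ->
  forall e : X, `|e| = 1 -> extreme_contraction T.
Proof.
move=> T1 Text e e1; split=> // A B t A1 B1 t01 TAB.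
have AB x : `|x| = 1 -> A x = T x /\ B x = T x.
  move=> x1; have [_ Tx] : extreme_points (@unit_ball R X) (T x).
    by apply: Text; exists x => //; exact: scX.
  apply: (Tx _ _ t) => //; last by rewrite TAB.
    by rewrite /unit_ball/= -x1; exact: op_unit_ball_contraction.
  by rewrite /unit_ball/= -x1; exact: op_unit_ball_contraction.
have hom C x : op_unit_ball C -> (forall x : X, `|x| = 1 -> C x = T x) -> C x = T x.
  move=> [[/linear_packP[Cl ->] _] _] CT.
  have [[/linear_packP[Tl TE] _] _] := T1; rewrite TE in CT *.
  have [->|x0] := eqVneq x 0; first by rewrite !linear0.
  have nx : `|x| != 0 by rewrite normr_eq0.
  rewrite -[x](scalerKV nx) linearZ [in RHS]linearZ/= CT//.
  by rewrite normrZ normfV normr_id mulVf.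
have unit1 x : `|x| = 1 -> unit_ball x by rewrite /unit_ball/= => ->.
by split; apply/funext => x; apply: hom => // z /AB[].
Qed.

Lemma isometry_extreme (T : X -> X) : (forall x : X, `|T x| = `|x|) ->
  forall e : X, `|e| = 1 ->
  T @` extreme_points (@unit_ball R X) `<=` extreme_points (@unit_ball R X).
Proof.
move=> iT e e1 _ [x xe <-]; apply: scX.
by rewrite /= iT; exact: norm_extreme_point e1 xe.
Qed.

Lemma extreme_isometry (T : X -> X) : linear T ->
  T @` extreme_points (@unit_ball R X) `<=` extreme_points (@unit_ball R X) ->
  forall x : X, `|T x| = `|x|.
Proof.
move=> /linear_packP[{}T ->] Text x.
have [->|x0] := eqVneq x 0; first by rewrite linear0.
have nx : `|x| != 0 by rewrite normr_eq0.
have x1 : `| `|x|^-1 *: x| = 1 by rewrite normrZ normfV normr_id mulVf.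
have /(norm_extreme_point x1) : extreme_points (@unit_ball R X) (T (`|x|^-1 *: x)).
  by apply: Text; exists (`|x|^-1 *: x) => //; exact: scX.
rewrite linearZ normrZ normfV normr_id => Tx.
by rewrite -[RHS]mulr1 -Tx mulrA divff// mul1r.
Qed.

Lemma hilbert_LP : is_hilbert X -> LP_property X X.
Proof.
move=> /is_hilbertP[f sf fE] T bT T1.
have [e e1] := op_norm1_nontrivial T1.
have uT : op_unit_ball T by split=> //; rewrite T1.
split=> [[_ exT]|Text]; last exact: (isometry_extreme_contraction uT Text e1).
apply: (isometry_extreme _ e1).
suff nz : ~ exists z : X, `|T z| != `|z|.
  by move=> x; apply: contrapT => /eqP Tx; apply: nz; exists x.
move=> /(contraction_perturbation sf fE bT.1 (op_unit_ball_contraction uT)).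
move=> [S [linS [x Sx] S1 S2]].
have [Tl TE] := linear_packP bT.1; have [Sl SE] := linear_packP linS.
have lD : linear (fun x => T x + S x).
  by move=> a u v; rewrite bT.1 linS scalerDr addrACA.
have lB : linear (fun x => T x - S x).
  by move=> a u v; rewrite bT.1 linS scalerBr opprD addrACA.
have [||+ _] := exT _ _ 2^-1 (contraction_op_unit_ball lD S1)
  (contraction_op_unit_ball lB S2).
- by apply/andP; split; lra.
- apply/funext => z; rewrite !fctE/=.
  rewrite (_ : 1 - 2^-1 = 2^-1 :> R); last lra.
  rewrite -scalerDr addrACA subrr addr0 -mulr2n -[T z *+ 2]scaler_nat scalerA.
  by rewrite mulVf ?scale1r.
move=> /(congr1 (@^~ x))/= /eqP; rewrite -subr_eq0 addrC addKr.
by rewrite (negbTE Sx).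
Qed.

End strictly_convex.

(** * Compactness and minimax *)

Lemma closed_preimage_le (R : realType) (T : topologicalType) (f : T -> R)
    (c : R) : continuous f -> closed [set w | f w <= c].
Proof.
by move=> cf; apply: (@preimage_closed _ _ f) (@closed_le _ c) => x _; exact: cf.
Qed.

(* Stated without [inf] and [sup]: [r] is the minimum over [C] of the supremum
   of the [F i]. *)
Lemma compact_minimax (R : realType) (T : topologicalType) (I : Type)
    (C : set T) (G : set I) (F : I -> T -> R) :
    compact C -> G !=set0 -> (forall i, continuous (F i)) ->
    (forall i w, 0 <= F i w) ->
    (exists M, exists2 w, C w & forall i, G i -> F i w <= M) ->
  exists r, (exists2 w, C w & forall i, G i -> F i w <= r) /\
    forall s w, C w -> (forall i, G i -> F i w <= s) -> r <= s.
Proof.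
move=> cC [i0 Gi0] cF F0 [M [w0 Cw0 FM]].
pose K s := [set w | C w /\ forall i, G i -> F i w <= s].
pose S := [set s | K s !=set0].
have lbS : lbound S 0 by move=> s [w [_ /(_ i0 Gi0)]]; exact: le_trans (F0 i0 w).
have infS : has_inf S by split; [exists M, w0 | exists 0].
exists (inf S); split; last first.
  move=> s w Cw Fs; apply: ge_inf; first exact: infS.2.
  by exists w.
(* The supremum of the [F i] is only lower semicontinuous; a minimiser is found as a cluster point
   of the nonempty sublevel sets [K s] with [inf S < s]. *)
have FF : ProperFilter (filter_from [set s | inf S < s] K).
  apply: filter_from_proper; last first.
    move=> s /= infs; have e0 : 0 < s - inf S by rewrite subr_gt0.
    have [t [w [Cw Fw]] ts] := inf_adherent e0 infS.
    exists w; split=> // i Gi; apply: le_trans (Fw i Gi) _.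
    by rewrite addrC subrK in ts; exact: ltW.
  apply: filter_from_filter; first by exists (inf S + 1); rewrite /= ltrDl.
  move=> s t /= Ss St; exists (Num.min s t); first by rewrite lt_min Ss.
  by move=> w [Cw Fw]; split; split=> // i /Fw; rewrite le_min => /andP[].
have [|w [Cw clw]] := cC _ FF.
  by exists (inf S + 1); [rewrite /= ltrDl | move=> w []].
exists w => // i Gi; apply/ler_addgt0Pr => e e0; rewrite leNgt; apply/negP => lt.
have [w' [[_ Fw'] /=]] : K (inf S + e) `&` [set w | inf S + e < F i w] !=set0.
  apply: clw; first by exists (inf S + e) => //=; rewrite ltrDl.
  exact: cvgr_gt (cF i w) _ lt.
by rewrite ltNge Fw'.
Qed.

(** * Euclidean geometry of row vectors *)

Section row_vectors.
Variables (R : realType) (N : nat).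
Implicit Types (A : set 'rV[R]_N) (u v w : 'rV[R]_N).

Lemma cvg_coord w i : u 0 i @[u --> w] --> w 0 i.
Proof. exact: (@coord_continuous R 1 N 0 i w). Qed.

Lemma linear_rV_continuous (V : normedModType R) (L : 'rV[R]_N -> V) :
  linear L -> continuous L.
Proof.
move=> /linear_packP[{}L ->].
rewrite (_ : L = (fun u => \sum_i u 0 i *: L (delta_mx 0 i)) :> (_ -> _)).
  apply: continuous_big => [|i _ w]; first exact: add_continuous.
  exact: cvgZr_tmp (@cvg_coord w i).
apply/funext => u; rewrite [u in LHS]row_sum_delta linear_sum.
by apply: eq_bigr => i _; rewrite linearZ.
Qed.

Lemma bounded_coord_compact A c :
  (forall v, A v -> forall i, `|v 0 i| <= c) -> closed A -> compact A.
Proof.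
move=> bA clA.
have cK : compact [set v : 'rV[R]_N | forall i, v ord0 i \in `[- c, c]].
  apply: (@rV_compact _ _ (fun=> `[- c, c]%classic)) => _.
  exact: segment_compact.
apply: subclosed_compact clA cK _ => v Av i.
by rewrite in_itv/= -ler_norml; exact: bA.
Qed.

(** The norm of ['rV[R]_N] is the maximum norm; the Euclidean one is strictly convex, as the search
    for extreme points requires. *)
Definition sumsq v := \sum_i v 0 i ^+ 2.

Lemma sumsq_ge0 v : 0 <= sumsq v.
Proof. by apply: sumr_ge0 => i _; exact: sqr_ge0. Qed.

Lemma coord_le_sumsq v i : v 0 i ^+ 2 <= sumsq v.
Proof.
rewrite /sumsq (bigD1 i)//= lerDl; apply: sumr_ge0 => j _; exact: sqr_ge0.
Qed.

Lemma sumsq_eq0 v : sumsq v = 0 -> v = 0.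
Proof.
move=> v0; apply/rowP => i; rewrite mxE; apply/eqP; rewrite -sqrf_eq0.
by rewrite eq_le sqr_ge0 andbT -v0 coord_le_sumsq.
Qed.

Lemma sumsq_continuous : continuous sumsq.
Proof.
apply: continuous_big => [|i _ w]; first exact: add_continuous.
exact: (cvgM (@cvg_coord w i) (@cvg_coord w i)).
Qed.

Lemma sumsqZ a v : sumsq (a *: v) = a ^+ 2 * sumsq v.
Proof. by rewrite mulr_sumr; apply: eq_bigr => i _; rewrite mxE exprMn. Qed.

Lemma sumsq_convex t u v : sumsq (t *: u + (1 - t) *: v) =
  t * sumsq u + (1 - t) * sumsq v - t * (1 - t) * sumsq (u - v).
Proof.
rewrite !mulr_sumr -big_split -sumrB/=; apply: eq_bigr => i _.
by rewrite !mxE; ring.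
Qed.

(* A point of maximal Euclidean norm is extreme. *)
Lemma compact_extreme_point A :
  A !=set0 -> compact A -> extreme_points A !=set0.
Proof.
move=> A0 cA.
have [|c /set_mem Ac maxc] := @EVT_max_rV R N sumsq A A0 cA.
  by apply: continuous_subspaceT; exact: sumsq_continuous.
exists c; split=> // y z t Ay Az /andP[t0 t1] cE.
have yz : y = z.
  apply/subr0_eq/sumsq_eq0/eqP; rewrite eq_le sumsq_ge0 andbT.
  have := maxc y (mem_set Ay); have := maxc z (mem_set Az).
  have := sumsq_convex t y z; rewrite -cE => /eqP; rewrite eq_sym => E.
  have t11 : 0 < 1 - t by rewrite subr_gt0.
  move=> hz hy; rewrite -(pmulr_rle0 _ (mulr_gt0 t0 t11)).
  have := ler_wpM2l (ltW t0) hy; have := ler_wpM2l (ltW t11) hz.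
  by move: E; rewrite subr_eq => /eqP; lra.
by rewrite cE yz -scalerDl addrC subrK scale1r.
Qed.

End row_vectors.

Section coordinates.
Variables (R : realType) (X : finDimBanachType R).
Local Notation n := (\dim {:X}).
Local Notation b := (vbasis {:X}).

Lemma vecof_continuous : continuous (vecof b : 'rV[R]_n -> X).
Proof. exact/linear_rV_continuous/linearP. Qed.

(** The constants are the extrema of the squared norm on the Euclidean unit sphere; [x0] is the
    minimiser rescaled to norm 1. *)
Lemma norm_sumsq_equiv (e : X) : `|e| = 1 ->
  exists m M : R, [/\ 0 < m, 0 < M,
    forall x : X, m * sumsq (rVof b x) <= `|x| ^+ 2 <= M * sumsq (rVof b x) &
    exists2 x0 : X, `|x0| = 1 & m * sumsq (rVof b x0) = 1].
Proof.
move=> e1.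
have rVofK := rVofK (vbasisP {:X}); have vecofK := vecofK (vbasisP {:X}).
pose S := [set v : 'rV[R]_n | sumsq v = 1].
have cS : compact S.
  apply: (@bounded_coord_compact _ _ _ 1).
    move=> v Sv i; rewrite -(@ler_pXn2r _ 2)// ?nnegrE// expr1n -[X in _ <= X]Sv.
    by rewrite -normrX ger0_norm ?sqr_ge0// coord_le_sumsq.
  apply: (@preimage_closed _ _ (@sumsq R n)) (@closed_eq _ 1) => x _.
  exact: sumsq_continuous.
have normalise (v : 'rV[R]_n) : v != 0 -> S ((Num.sqrt (sumsq v))^-1 *: v).
  move=> v0; rewrite /S/= sumsqZ exprVn sqr_sqrtr ?sumsq_ge0// mulVf//.
  by apply: contra_neq v0; exact: sumsq_eq0.
have e0 : rVof b e != 0.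
  apply/eqP => h; move: e1; rewrite -(rVofK e) h linear0 normr0 => /esym/eqP.
  by rewrite oner_eq0.
have S0 : S !=set0 by exists ((Num.sqrt (sumsq (rVof b e)))^-1 *: rVof b e); exact: normalise.
pose F v : R := `|vecof b v| ^+ 2.
have cF : {within S, continuous F}.
  apply: continuous_subspaceT => v; rewrite /F.
  have cn : `|vecof b w| @[w --> v] --> `|vecof b v|.
    exact: (cvg_norm (@vecof_continuous v)).
  exact: (cvgM cn cn).
have [u /set_mem Su minu] := EVT_min_rV S0 cS cF.
have [w /set_mem Sw maxw] := EVT_max_rV S0 cS cF.
have F0 v : S v -> 0 < F v.
  move=> Sv; rewrite exprn_gt0// normr_gt0; apply/eqP => h.
  have v0 : v = 0 by rewrite -(vecofK v) h linear0.
  move: Sv; rewrite /S/= v0 /sumsq big1; last by move=> i _; rewrite mxE expr0n.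
  by move/esym/eqP; rewrite oner_eq0.
have FE (x : X) : x != 0 -> let v := rVof b x in
    `|x| ^+ 2 = F ((Num.sqrt (sumsq v))^-1 *: v) * sumsq v.
  move=> x0 v; rewrite /F linearZ/= normrZ exprMn rVofK.
  rewrite -normrX ger0_norm ?sqr_ge0// exprVn sqr_sqrtr ?sumsq_ge0//.
  rewrite mulrAC mulVf ?mul1r//.
  by apply: contra_neq x0 => /sumsq_eq0 v0; rewrite -(rVofK x) -/v v0 linear0.
exists (F u), (F w); split; [exact: F0|exact: F0| |].
  move=> x; have [->|x0] := eqVneq x 0.
    by rewrite linear0 /sumsq big1 ?mulr0 ?normr0 ?expr0n ?lexx// => i _; rewrite mxE expr0n.
  have v0 : rVof b x != 0.
    by apply: contra_neq x0 => v0; rewrite -(rVofK x) v0 linear0.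
  rewrite (FE x x0) !ler_wpM2r ?sumsq_ge0//.
    by apply: maxw; apply/mem_set; exact: normalise.
  by apply: minu; apply/mem_set; exact: normalise.
have nu : 0 < `|vecof b u|.
  by rewrite normr_gt0 -normr_eq0; have := F0 u Su; rewrite /F exprn_even_gt0.
exists (`|vecof b u|^-1 *: vecof b u).
  by rewrite normrZ normfV normr_id mulVf// gt_eqF.
rewrite linearZ/= vecofK sumsqZ Su mulr1 /F -exprMn divff ?expr1n// gt_eqF//.
Qed.

End coordinates.

(** * From the L-P property to an inner product *)

Section backward.
Variables (R : realType) (X : finDimBanachType R).
Local Notation n := (\dim {:X}).
Local Notation b := (vbasis {:X}).
Let b_basis : basis_of {:X} b := vbasisP {:X}.

(** The set where [D x x <= 1] is an ellipsoid containing the unit ball and touching its sphere at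
    [x0]. The constant [a] later keeps the forms in a compact set definite. *)
Lemma inscribed_form (e : X) : `|e| = 1 -> exists D : X -> X -> R,
  [/\ sym_bilinear D, exists2 a, 0 < a & forall x : X, a * `|x| ^+ 2 <= D x x,
      forall x : X, D x x <= `|x| ^+ 2 & exists2 x0 : X, `|x0| = 1 & D x0 x0 = 1].
Proof.
move=> /norm_sumsq_equiv[m [M [m0 M0 mM [x0 x01 mx0]]]].
exists (fun x y => m * \sum_i rVof b x 0 i * rVof b y 0 i).
split; last by exists x0 => //; under eq_bigr do rewrite -expr2.
- split=> [z a x y|x y]; last by under eq_bigr do rewrite mulrC.
  rewrite mulrCA -mulrDr; congr (_ * _); rewrite mulr_sumr -big_split/=.
  by apply: eq_bigr => i _; rewrite linearP !mxE mulrDl mulrA.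
- exists (m / M); first by rewrite divr_gt0.
  move=> x; rewrite -mulrA ler_pM2l// ler_pdivrMl//; under eq_bigr do rewrite -expr2.
  by have /andP[] := mM x.
- by move=> x; under eq_bigr do rewrite -expr2; have /andP[] := mM x.
Qed.

Lemma coord_bound (e : X) : `|e| = 1 ->
  exists2 c, 0 <= c & forall (x : X) i, `|rVof b x 0 i| <= c * `|x|.
Proof.
move=> /norm_sumsq_equiv[m [M [m0 M0 mM _]]].
exists (Num.sqrt m^-1) => [|x i]; first exact: sqrtr_ge0.
rewrite -(@ler_pXn2r _ 2)// ?nnegrE ?mulr_ge0 ?sqrtr_ge0//.
rewrite real_normK ?num_real// exprMn sqr_sqrtr; last by rewrite invr_ge0 ltW.
rewrite ler_pdivlMl//.
apply: le_trans (ler_wpM2l (ltW m0) (coord_le_sumsq _ i)) _.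
by have /andP[] := mM x.
Qed.

Section operators.
Implicit Types (w : 'rV[R]_(n * n)) (x y : X).

(** Flattened matrices give the operators a topology in which compactness is available; being linear
    and injective, the encoding transfers extreme points. *)
Definition mxop w : X -> X := hommx b b (vec_mx w).

Lemma mxopE w x : mxop w x = vecof b (rVof b x *m vec_mx w).
Proof. exact: hommxE. Qed.

Lemma mxop_linear w : linear (mxop w). Proof. exact: linearP. Qed.

Lemma mxop_linear_param x : linear (mxop^~ x).
Proof. by move=> a u v; rewrite !mxopE !linearP. Qed.

Lemma mxop_continuous x : continuous (mxop^~ x).
Proof. exact/linear_rV_continuous/mxop_linear_param. Qed.

Lemma mxop_entry w (i j : 'I_n) : rVof b (mxop w b`_i) 0 j = w 0 (mxvec_index i j).
Proof.
by rewrite mxopE vecofK// rVofE// -rowE mxE -[in RHS](vec_mxK w) mxvecE.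
Qed.

Lemma mxop_surj (A : X -> X) : linear A -> exists w, mxop w = A.
Proof.
move=> /linear_packP[{}A ->]; exists (mxvec (mxof b b (linfun A))).
by apply/funext => x; rewrite /mxop mxvecK mxofK// lfunE.
Qed.

Lemma mxop_inj : injective mxop.
Proof.
move=> w w' ww'; apply/rowP => k; case/mxvec_indexP: k => i j.
by rewrite -!mxop_entry ww'.
Qed.

End operators.

Hypothesis scX : strictly_convex X.

(* Contractions mapping [x0] to [y] form a face of the unit ball since [y] is
   extreme, so an extreme point of this face is an extreme contraction, hence an
   isometry. The face is nonempty for a contact point [x0] of the sphere with an
   inscribed ellipsoid, whose form provides a functional supporting the ball at
   [x0]. *)
Lemma LP_isometry_transitive : LP_property X X ->
  forall e : X, `|e| = 1 -> exists2 x0 : X, `|x0| = 1 &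
  forall y : X, `|y| = 1 -> exists T : X -> X,
    [/\ linear T, forall x : X, `|T x| = `|x| & T x0 = y].
Proof.
move=> LP e e1.
have [D [sD [a a0 aD] D1 [x0 x01 Dx0]]] := inscribed_form e1.
have [c c0 cb] := coord_bound e1.
exists x0 => // y y1.
pose K := [set w | mxop w x0 = y /\ forall x : X, `|mxop w x| <= `|x|].
have clK : closed K.
  have -> : K = [set w | `|mxop w x0 - y| <= 0] `&`
      \bigcap_(x in [set: X]) [set w | `|mxop w x| <= `|x| ].
    apply/seteqP; split=> w /=.
      by move=> [-> cw]; split=> [|x _]; [rewrite subrr normr0 | exact: cw].
    rewrite normr_le0 subr_eq0 => -[/eqP wx0 cw]; split=> // x; exact: cw.
  apply: closedI.
    apply: closed_preimage_le => w.
    have cw := @mxop_continuous x0 w; have cy := cvg_cst y.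
    exact: (cvg_norm (cvgB cw (cy _ _ _))).
  apply: closed_bigI => x _; apply: closed_preimage_le => w.
  exact: (cvg_norm (@mxop_continuous x w)).
have cK : compact K.
  apply: (@bounded_coord_compact _ _ _ (c * \sum_(i < n) `|b`_i|)) clK.
  move=> w [_ cw] k; case/mxvec_indexP: k => i j; rewrite -mxop_entry.
  apply: le_trans (cb _ _) _; apply: ler_wpM2l => //.
  apply: le_trans (cw _) _; rewrite (bigD1 i)//= lerDl.
  by apply: sumr_ge0.
have K0 : K !=set0.
  (* A rank one contraction: since [D x0 x0 = 1], positivity of [D] at [x - D x x0 *: x0] reads
     [D x x0 ^+ 2 <= D x x]. *)
  have [|w wE] := @mxop_surj (fun z => D z x0 *: y).
    by move=> k u v; rewrite sD.1 scalerDl scalerA.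
  exists w; rewrite /K/= wE; split=> [|x]; first by rewrite Dx0 scale1r.
  rewrite normrZ y1 mulr1 -(@ler_pXn2r _ 2)// ?nnegrE//.
  rewrite real_normK ?num_real//; apply: le_trans (D1 x).
  have := aD (x - D x x0 *: x0); rewrite (sfBl sD) !(sfBr sD) !(sfZl sD) !(sfZr sD).
  rewrite Dx0 (sfC sD x0 x).
  have : 0 <= a * `|x - D x x0 *: x0| ^+ 2 by rewrite mulr_ge0 ?sqr_ge0// ltW.
  by lra.
have [w [[wx0 cw] extw]] := compact_extreme_point K0 cK.
have uT := contraction_op_unit_ball (@mxop_linear w) cw.
have y_ext := scX y1.
have T1 : op_norm (mxop w) = 1.
  by apply: (contraction_op_norm cw x01); rewrite wx0.
have eT : extreme_contraction (mxop w).
  split=> // A B t A1 B1 t01 TAB.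
  have cA := op_unit_ball_contraction A1; have cB := op_unit_ball_contraction B1.
  have uball (C : X -> X) : (forall z : X, `|C z| <= `|z|) -> unit_ball (C x0).
    by move=> cC; rewrite /unit_ball/= -x01.
  have [|Ax0 Bx0] := y_ext.2 _ _ t (uball _ cA) (uball _ cB) t01.
    by rewrite -wx0 TAB.
  have [wA wAE] := mxop_surj A1.1.1.
  have [wB wBE] := mxop_surj B1.1.1.
  have [||//||wAw wBw] := extw wA wB t; last by rewrite -wAE -wBE wAw wBw.
  - by split; rewrite wAE.
  - by split; rewrite wBE.
  apply: mxop_inj; rewrite TAB -wAE -wBE; apply/funext => x.
  by rewrite [RHS]mxopE linearD !linearZ/= mulmxDr -!scalemxAr linearD !linearZ/= -!mxopE.
exists (mxop w); split=> //; first exact: mxop_linear.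
apply: (extreme_isometry scX (@mxop_linear w)).
by apply/(LP _ uT.1 T1).
Qed.

(** * Bilinear forms invariant under isometries *)

Section forms.
Implicit Types (w : 'rV[R]_(n * n)) (x y : X).

Definition mxform w x y : R := (rVof b x *m vec_mx w *m (rVof b y)^T) 0 0.

Lemma mxform_linear_param x y : scalar (fun w => mxform w x y).
Proof. by move=> a u v; rewrite /mxform linearP/= mulmxDr -scalemxAr mulmxDl -scalemxAl !mxE. Qed.

Lemma mxform_continuous x y : continuous (fun w => mxform w x y).
Proof. exact: (@linear_rV_continuous _ _ R^o _ (mxform_linear_param x y)). Qed.

Lemma mxform_linearl w y : scalar (fun x => mxform w x y).
Proof. by move=> a u v; rewrite /mxform linearP/= !mulmxDl -!scalemxAl !mxE. Qed.

Lemma mxform_linearr w x : scalar (mxform w x).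
Proof. by move=> a u v; rewrite /mxform linearP/= linearP/= mulmxDr -scalemxAr !mxE. Qed.

Lemma mxform_entry w (i j : 'I_n) : mxform w b`_i b`_j = w 0 (mxvec_index i j).
Proof.
rewrite /mxform !rVofE// trmx_delta -rowE -colE mxE [LHS]mxE.
by rewrite -[in RHS](vec_mxK w) mxvecE.
Qed.

Lemma mxform_surj (f : X -> X -> R) : sym_bilinear f -> exists w, mxform w = f.
Proof.
move=> sf; exists (mxvec (\matrix_(i, j) f b`_i b`_j)).
set w := mxvec _; apply/funext => x; apply/funext => y; move: x.
apply: (@eq_scalar_basis _ _ (fun x => mxform w x y) (f^~ y)).
- exact: mxform_linearl.
- exact: sf.1.
move=> i; move: y; apply: eq_scalar_basis.
- exact: mxform_linearr.
- by move=> a u v; rewrite (sfDr sf) (sfZr sf).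
by move=> j; rewrite mxform_entry mxvecE mxE.
Qed.

End forms.

(** By polarization [4 * f x y] is a difference of two numbers between 0 and the bound. *)
Lemma sym_bilinear_bound (f : X -> X -> R) : sym_bilinear f ->
  (forall x : X, 0 <= f x x <= `|x| ^+ 2) ->
  forall x y : X, `|f x y| <= (`|x| + `|y|) ^+ 2.
Proof.
move=> sf fb x y.
have /andP[p0 p1] := fb (x + y); have /andP[m0 m1] := fb (x - y).
have pE : f (x + y) (x + y) - f (x - y) (x - y) = 4 * f x y.
  rewrite !(sfBl sf, sfBr sf, sfDl sf, sfDr sf) (sfC sf y x); ring.
have p2 : `|x + y| ^+ 2 <= (`|x| + `|y|) ^+ 2.
  by rewrite ler_pXn2r ?nnegrE ?addr_ge0// ler_normD.
have m2 : `|x - y| ^+ 2 <= (`|x| + `|y|) ^+ 2.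
  by rewrite ler_pXn2r ?nnegrE ?addr_ge0// ler_normB.
by rewrite ler_norml; lra.
Qed.

(* [x = g y] with [y] of the same norm as [x], so the coordinates of [x] in the
   basis [g b] are bounded independently of [g]. *)
Lemma isometry_form_lower_bound (d : X -> X -> R) (x : X) :
  sym_bilinear d -> d x x != 0 -> exists2 delta, 0 < delta &
  forall g : X -> X, linear g -> (forall z : X, `|g z| = `|z|) ->
  delta <= \sum_(p : 'I_n * 'I_n) d (g b`_p.1) (g b`_p.2) ^+ 2.
Proof.
move=> sd dx.
have x0 : x != 0 by apply: contra_neq dx => ->; rewrite (sf0l sd).
have [|c c0 cb] := @coord_bound (`|x|^-1 *: x).
  by rewrite normrZ normfV normr_id mulVf// normr_eq0.
pose k := c * `|x|; have k0 : 0 <= k by rewrite mulr_ge0.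
pose m : R := #|{: 'I_n * 'I_n}|%:R.
have m0 : 0 <= m by [].
(* If all entries were at most [eta] in absolute value, then [d x x] would be at most
   [k ^+ 2 * m * eta], which the added 1 makes smaller than its absolute value. *)
pose eta := `|d x x| / (k ^+ 2 * m + 1).
have den : 0 < k ^+ 2 * m + 1 by rewrite ltr_wpDl// mulr_ge0// sqr_ge0.
have eta0 : 0 < eta by rewrite divr_gt0// normr_gt0.
exists (eta ^+ 2) => [|g ling ig]; first exact: exprn_gt0.
rewrite leNgt; apply/negP => lt.
have small (p : 'I_n * 'I_n) : `|d (g b`_p.1) (g b`_p.2)| <= eta.
  rewrite -(@ler_pXn2r _ 2)// ?nnegrE// ?(ltW eta0)// real_normK ?num_real//.
  apply: le_trans (ltW lt); rewrite (bigD1 p)//= lerDl.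
  by apply: sumr_ge0 => q _; exact: sqr_ge0.
have g0 z : g z = 0 -> z = 0 by move=> gz; apply/eqP; rewrite -normr_eq0 -ig gz normr0.
have [y gy] := linear_inj_surj ling g0 x.
have ny : `|y| = `|x| by rewrite -gy ig.
have [gl glE] := linear_packP ling.
have dE : d x x =
    \sum_(p : 'I_n * 'I_n) rVof b y 0 p.1 * rVof b y 0 p.2 * d (g b`_p.1) (g b`_p.2).
  have xE : x = \sum_i rVof b y 0 i *: g b`_i.
    rewrite -gy -[y in LHS](rVofK b_basis) glE linear_sum.
    by apply: eq_bigr => i _; rewrite linearZ.
  rewrite -(pair_bigA _ (fun i j => rVof b y 0 i * rVof b y 0 j * d (g b`_i) (g b`_j)))/=.
  have dsum z : d x z = \sum_i rVof b y 0 i * d (g b`_i) z.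
    have [dl dlE] := linear_packP (sd.1 z : linear (d^~ z : X -> R^o)).
    have dlE' u : d u z = dl u by rewrite -dlE.
    rewrite dlE' xE linear_sum; apply: eq_bigr => i _.
    by rewrite linearZ/= -dlE'.
  rewrite dsum; apply: eq_bigr => i _.
  rewrite (sfC sd) dsum mulr_sumr; apply: eq_bigr => j _.
  by rewrite mulrA (sfC sd (g b`_j)).
have : `|d x x| <= k ^+ 2 * m * eta.
  rewrite {1}dE (le_trans (ler_norm_sum _ _ _))//.
  apply: (@le_trans _ _ (\sum_(p : 'I_n * 'I_n) k ^+ 2 * eta)).
    apply: ler_sum => p _; rewrite !normrM; apply: ler_pM => //.
    by rewrite expr2; apply: ler_pM => //; rewrite /k -ny; exact: cb.
  by rewrite sumr_const -[_ *+ _]mulr_natr -/m mulrAC.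
have dd : (k ^+ 2 * m + 1) * eta = `|d x x| by rewrite /eta mulrC divfK// gt_eqF.
by rewrite -dd mulrDl mul1r gerDl leNgt eta0.
Qed.
(* Among the forms equivalent to the squared norm with fixed constants, the one
   minimising the largest Euclidean norm of its images under the isometries is
   unique by strict convexity, hence invariant. *)
Lemma isometry_invariant_form (e : X) : `|e| = 1 -> exists f : X -> X -> R,
  [/\ sym_bilinear f, forall x : X, x != 0 -> 0 < f x x &
      forall T : X -> X, linear T -> (forall x : X, `|T x| = `|x|) ->
      forall x, f (T x) (T x) = f x x].
Proof.
move=> e1; have [D [sD [a a0 aD] D1 _]] := inscribed_form e1.
pose C := [set w : 'rV[R]_(n * n) | (forall x y, mxform w x y = mxform w y x) /\
  forall x : X, a * `|x| ^+ 2 <= mxform w x x <= `|x| ^+ 2].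
have symC w : C w -> sym_bilinear (mxform w).
  by move=> [sw _]; split=> //; exact: mxform_linearl.
have bndC w : C w -> forall x y : X, `|mxform w x y| <= (`|x| + `|y|) ^+ 2.
  move=> Cw; apply: (sym_bilinear_bound (symC w Cw)) => x.
  have /andP[h ->] := Cw.2 x; rewrite andbT; apply: le_trans h.
  by rewrite mulr_ge0 ?sqr_ge0// ltW.
have cC : compact C.
  apply: (@bounded_coord_compact _ _ _ (\sum_(p : 'I_n * 'I_n) (`|b`_p.1| + `|b`_p.2|) ^+ 2)).
    move=> w Cw k; case/mxvec_indexP: k => i j; rewrite -mxform_entry.
    apply: le_trans (bndC _ Cw _ _) _; rewrite (bigD1 (i, j))//= lerDl.
    by apply: sumr_ge0 => p _; exact: sqr_ge0.
  have -> : C = \bigcap_(p in [set: X * X])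
      ([set w | mxform w p.1 p.2 - mxform w p.2 p.1 <= 0] `&`
       ([set w | - mxform w p.1 p.1 <= - (a * `|p.1| ^+ 2)] `&`
        [set w | mxform w p.1 p.1 <= `|p.1| ^+ 2])).
    apply/seteqP; split=> [w [sw bw] [x y] _ /=|w wP].
      rewrite sw subrr lexx lerN2; split=> //.
      by have /andP[] := bw x.
    split=> [x y|x]; last first.
      by have [_ [/= + ->]] := wP (x, x) I; rewrite lerN2 => ->.
    have [/= + _] := wP (x, y) I; have [/= + _] := wP (y, x) I.
    by rewrite !subr_le0 => h1 h2; apply/eqP; rewrite eq_le h1 h2.
  apply: closed_bigI => -[x y] _.
  apply: closedI; last apply: closedI; apply: closed_preimage_le => w.
  - exact: (cvgB (@mxform_continuous x y w) (@mxform_continuous y x w)).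
  - exact: (cvgN (@mxform_continuous x x w)).
  - exact: mxform_continuous.
pose G := [set g : X -> X | linear g /\ forall z : X, `|g z| = `|z|].
(* The squared Euclidean norm of the Gram matrix of the form on the basis moved by [g]. Pulling the
   form back by [T] turns [g] into [T \o g], so the bound [r] persists. *)
pose F (g : X -> X) (w : 'rV[R]_(n * n)) :=
  \sum_(p : 'I_n * 'I_n) mxform w (g b`_p.1) (g b`_p.2) ^+ 2.
have [||||r [[w Cw Fw] minr]] := @compact_minimax R _ _ C G F cC.
- by exists idfun; split.
- move=> g; apply: continuous_big => [|p _ w]; first exact: add_continuous.
  have h := @mxform_continuous (g b`_p.1) (g b`_p.2) w.
  exact: (cvgM h h).
- by move=> g w; apply: sumr_ge0 => p _; exact: sqr_ge0.
- have [w wD] := mxform_surj sD.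
  have Cw : C w.
    by split=> [x y|x]; rewrite wD ?(sfC sD x)// aD D1.
  exists (\sum_(p : 'I_n * 'I_n) ((`|b`_p.1| + `|b`_p.2|) ^+ 2) ^+ 2), w => // g [_ ig].
  apply: ler_sum => p _; rewrite -real_normK ?num_real//.
  rewrite ler_pXn2r ?nnegrE ?sqr_ge0//.
  by have := bndC _ Cw (g b`_p.1) (g b`_p.2); rewrite !ig.
have sw := symC w Cw.
exists (mxform w); split=> // [x x0|T linT iT x].
  have /andP[+ _] := Cw.2 x; apply: lt_le_trans.
  by rewrite mulr_gt0// exprn_gt0// normr_gt0.
have [w' w'E] := mxform_surj (sym_bilinear_comp linT sw).
have Cw' : C w'.
  split=> [u v|u]; rewrite w'E; first exact: (sfC sw).
  by have := Cw.2 (T u); rewrite iT.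
have sd := sym_bilinearB (symC w' Cw') sw.
apply/eqP; rewrite -subr_eq0; apply: contrapT => /negP dx.
have [|delta delta0 lb] := isometry_form_lower_bound (x := x) sd.
  by rewrite w'E.
pose v := 2^-1 *: w + 2^-1 *: w'.
have vE u z : mxform v u z = 2^-1 * mxform w u z + 2^-1 * mxform w' u z.
  have := mxform_linear_param u z 2^-1 w (2^-1 *: w'); rewrite /v => ->.
  congr (_ + _); have := mxform_linear_param u z 2^-1 w' 0; rewrite addr0 => ->.
  by rewrite [X in _ + X](_ : _ = 0) ?addr0// /mxform linear0 mulmx0 mul0mx mxE.
have Cv : C v.
  split=> [u z|u]; rewrite !vE; first by rewrite Cw.1 Cw'.1.
  by have := Cw.2 u; have := Cw'.2 u; lra.
(* By the parallelogram identity the midpoint [v] lowers the bound on each [F g] by [delta / 4]; as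
   [delta] is independent of [g], this contradicts the minimality of [r]. *)
suff : r <= r - delta / 4 by lra.
apply: (minr _ v) => // g [ling ig].
have Gg' : G (T \o g).
  split=> [k u z|z]; last by rewrite /= iT ig.
  by rewrite /= ling linT.
have F1 : F g w <= r by apply: Fw.
have F2 : F g w' <= r by have := Fw _ Gg'; rewrite /F w'E.
have := lb g ling ig.
rewrite [X in _ <= X -> _](_ : _ = 2 * F g w + 2 * F g w' - 4 * F g v); first by lra.
rewrite /F !mulr_sumr -big_split -sumrB/=; apply: eq_bigr => p _.
by rewrite vE; field.
Qed.

Lemma LP_hilbert : LP_property X X -> is_hilbert X.
Proof.
move=> LP; apply/is_hilbertP.
(* The zero space has no unit vector to start from; the zero form serves there. *)
have [[z z0]|triv] := pselect (exists z : X, z != 0); last first.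
  have X0 (x : X) : x = 0 by apply: contrapT => /eqP x0; apply: triv; exists x.
  exists (fun _ _ => 0) => [|x]; last by rewrite (X0 x) normr0 expr0n.
  by split=> // _ k u v /=; rewrite mulr0 addr0.
have z1 : `| `|z|^-1 *: z | = 1 by rewrite normrZ normfV normr_id mulVf// normr_eq0.
have [x0 x01 trans] := LP_isometry_transitive LP z1.
have [f [sf f0 inv]] := isometry_invariant_form z1.
have x0n0 : x0 != 0 by rewrite -normr_eq0 x01 oner_eq0.
have c0 : f x0 x0 != 0 by rewrite gt_eqF// f0.
exists (fun x y => (f x0 x0)^-1 * f x y).
  split=> [y a u v|x y]; last by rewrite (sfC sf).
  by rewrite sf.1 mulrDr mulrCA.
move=> x; have [->|xn0] := eqVneq x 0; first by rewrite (sf0l sf) mulr0 normr0 expr0n.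
have nx : `|x| != 0 by rewrite normr_eq0.
have y1 : `| `|x|^-1 *: x | = 1 by rewrite normrZ normfV normr_id mulVf.
have [T [linT iT Tx0]] := trans _ y1.
rewrite -(inv T linT iT x0) Tx0 (sfZl sf) (sfZr sf).
have := f0 x xn0; move: (f x x) => c /gt_eqF/negbT cn0.
by field; rewrite nx cn0.
Qed.

End backward.

Theorem theorem2p12 (R : realType) (X : finDimBanachType R)
    (hX : strictly_convex X) :
  is_hilbert X <-> LP_property X X.
Proof. by split; [exact: hilbert_LP | exact: LP_hilbert]. Qed.
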